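(* Let $\theta^*$ be an optimal solution of OPT with completion times $T_1^*,\dots,T_M^*$, and let $c_{i,j}$ be the constants from the CDR Rule (for every pair $i,j$, $s'(\theta_i^*(t))/s'(\theta_j^*(t))=c_{i,j}$ whenever $\theta_i^*(t)>0$ and $\theta_j^*(t)>0$). Let $i,j$ be jobs and $t_1,t_2$ times with $\max\{t_1,t_2\}<\min\{T_i^*,T_j^*\}$ such that $\theta_i^*(t_1)>0$, $\theta_j^*(t_1)>0$, $\theta_i^*(t_2)>0$ and $\theta_j^*(t_2)=0$. Then $$c_{i,j}=\frac{s'(\theta_i^*(t_1))}{s'(\theta_j^*(t_1))}\le\frac{s'(\theta_i^*(t_2))}{s'(0)}.$$
   Context: Setting (problem OPT). There are $M$ jobs, all available at time $0$, with sizes $x_1\ge x_2\ge\cdots\ge x_M>0$ and weights $0<w_1\le w_2\le\cdots\le w_M$. A total resource $B>0$ is shared. The speedup function $s:[0,B]\to[0,\infty)$ satisfies: $s(0)=0$; $s$ is strictly increasing, strictly concave, differentiable, and $s'$ is continuous on $[0,B]$ (so $s'>0$ and $s'$ is strictly decreasing). A schedule consists of functions $\theta_i:(0,\infty)\to[0,B]$, $i=1,\dots,M$, each right-continuous in $t$, with $\sum_{i=1}^M\theta_i(t)\le B$ for all $t>0$. The service received by job $i$ on $[t_1,t_2]$ is $Q_i(t_1,t_2)=\int_{t_1}^{t_2}s(\theta_i(t))\,dt$. The completion time $T_i$ of job $i$ satisfies $Q_i(0,T_i)=x_i$, and $\theta_i(t)=0$ for $t>T_i$. OPT is the problem of choosing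 a schedule minimizing $J=\sum_{i=1}^M w_iT_i$. An optimal solution is a feasible schedule attaining the minimum; $T_i^*$ denotes its completion times. *)

(* Defs.v *)
From HB Require Import structures.
From mathcomp Require Import all_boot all_order all_algebra.
From mathcomp Require Import all_classical all_reals all_analysis.
Set Implicit Arguments. Unset Strict Implicit. Unset Printing Implicit Defensive.
Import Order.TTheory GRing.Theory Num.Theory.
Import numFieldNormedType.Exports.
Local Open Scope classical_set_scope.
Local Open Scope ring_scope.

Section OPT.
Variable R : realType.

Definition deriv_within (D : set R) (f : R -> R) (x l : R) : Prop :=
  (fun y => (f y - f x) / (y - x)) @ within (D `\ x) (nbhs x) --> l.

Definition speedup (B : R) (s ds : R -> R) : Prop :=
  [/\ s 0 = 0,
      (forall a b, 0 <= a -> a < b -> b <= B -> s a < s b),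
      (forall a b l, 0 <= a <= B -> 0 <= b <= B -> a != b -> 0 < l < 1 ->
          l * s a + (1 - l) * s b < s (l * a + (1 - l) * b)),
      (forall x, 0 <= x <= B -> deriv_within `[0, B] s x (ds x)) &
      {within `[0, B], continuous ds}].

Definition service (s : R -> R) (th : R -> R) (t1 t2 : R) : \bar R :=
  (\int[lebesgue_measure]_(t in `]t1, t2]) (s (th t))%:E)%E.

Definition feasible (M : nat) (B : R) (s : R -> R) (x : 'I_M -> R)
    (th : 'I_M -> R -> R) (T : 'I_M -> R) : Prop :=
  [/\ (forall i t, 0 < t -> 0 <= th i t <= B),
      (forall i t, 0 < t -> th i @ t^'+ --> th i t),
      (forall t, 0 < t -> \sum_(i < M) th i t <= B),
      (forall i, service s (th i) 0 (T i) = (x i)%:E) &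
      (forall i t, T i < t -> th i t = 0)].

Definition cost (M : nat) (w : 'I_M -> R) (T : 'I_M -> R) : R :=
  \sum_(i < M) w i * T i.

Definition optimal (M : nat) (B : R) (s : R -> R) (x w : 'I_M -> R)
    (th : 'I_M -> R -> R) (T : 'I_M -> R) : Prop :=
  feasible B s x th T /\
  forall th' T', feasible B s x th' T' -> cost w T <= cost w T'.

End OPT.

(* Main.v *)
Require Import Defs.
From HB Require Import structures.
From mathcomp Require Import all_boot all_order all_algebra.
From mathcomp Require Import all_classical all_reals all_analysis.
From mathcomp Require Import measurable_realfun ring lra.
Import Order.TTheory GRing.Theory Num.Theory.
Import numFieldNormedType.Exports.
Set Implicit Arguments.
Unset Strict Implicit.
Local Open Scope classical_set_scope.
Local Open Scope ring_scope.

(* Suppose s'(θ_i(t1)) s'(0) > s'(θ_j(t1)) s'(θ_i(t2)). Right after t1 move a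
   small rate h from j to i, and right after t2 give back the rate r h from i
   to j, on windows of equal length, with s'(θ_j(t1)) / s'(0) < r and
   r s'(θ_i(t2)) < s'(θ_i(t1)). To first order both i and j then receive
   strictly more service by their completion times, so their schedules can be
   cut off earlier, contradicting optimality. *)

(** * Right-continuity and measurability *)

Lemma right_nearP (R : realType) (t : R) (P : R -> Prop) :
  (\forall u \near t^'+, P u) ->
  exists2 d : R, 0 < d & forall u : R, t < u < t + d -> P u.
Proof.
rewrite near_withinE => -[d /= d0 dP]; exists d => // u /andP[tu ud].
by apply: dP => //=; rewrite distrC gtr0_norm; lra.
Qed.

(** Schedules are only assumed right-continuous, so measurability must be derived before
    integrating. By right-continuity, [c < f t] means that on some interval to the right of [t] the
    values of [f] at rational points are at least some rational [e > c]; this is a countable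
    condition. *)
Lemma right_continuous_measurable (R : realType) (a : R) (f : R -> R) :
  (forall t : R, a < t -> f @ t^'+ --> f t) -> measurable_fun `]a, +oo[ f.
Proof.
move=> fc; apply: (measurability _ (RGenOInfty.measurableE R)).
move=> _ [_ [c ->] <-].
have -> : `]a, +oo[ `&` f @^-1` `]c, +oo[ =
  `]a, +oo[ `&` \bigcup_(e : rat) \bigcup_(q : rat)
    ([set t : R | t < ratr q /\ c < ratr e] `&`
     \bigcap_(p : rat)
       [set t : R | t < ratr p < (ratr q : R) -> ratr e <= f (ratr p)]).
  apply/seteqP; split => [t /= []|t []] /=; rewrite !in_itv /= !andbT => ta.
  - move=> cf; split=> //.
    have [e ce ef] : exists2 e : rat, c < ratr e & ratr e < f t.
      by have [e] := rat_in_itvoo cf; rewrite in_itv/= => /andP[? ?]; exists e.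
    have [d d0 df] := right_nearP (cvgr_ge _ (fc _ ta) _ ef).
    have [q] := @rat_in_itvoo _ t (t + d) ltac:(lra).
    rewrite in_itv/= => /andP[tq qd].
    exists e => //; exists q => //; split => //= p _ /= /andP[tp pq].
    by apply: df; rewrite tp/= (lt_trans pq).
  - move=> [e _ [q _ [[tq ce] H]]]; split => //.
    apply: (lt_le_trans ce); rewrite leNgt; apply/negP => fe.
    have [d d0 df] := right_nearP (cvgr_lt _ (fc _ ta) _ fe).
    have [p] := @rat_in_itvoo _ t (Num.min (t + d) (ratr q))
      ltac:(rewrite lt_min tq; lra).
    rewrite in_itv/= lt_min => /and3P[tp pd pq].
    have := H p I; rewrite /= tp pq => /(_ isT); apply/negP.
    by rewrite -ltNge; apply: df; rewrite tp.
apply: measurableI => //.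
apply: bigcupT_measurable_rat => e.
apply: bigcupT_measurable_rat => q.
apply: measurableI.
  have [ce|ce] := boolP (c < (ratr e : R)); last first.
    rewrite [X in measurable X](_ : _ = set0)//.
    by apply/seteqP; split => // t [].
  rewrite [X in measurable X](_ : _ = `]-oo, ratr q[%classic)//.
  by apply/seteqP; split => t /=; rewrite in_itv/= => // -[].
(* For a fixed [p], the condition on [t] either always holds or says exactly [ratr p <= t], so each
   set is [setT] or a closed half-line. *)
rewrite -[X in measurable X]setCK setC_bigcap; apply: measurableC.
apply: bigcupT_measurable_rat => p; apply: measurableC.
have [pq|pq] := boolP ((ratr p < (ratr q : R)) && (f (ratr p) < ratr e)).
  rewrite [X in measurable X](_ : _ = `[ratr p, +oo[%classic)//.
  case/andP: pq => pq fe; apply/seteqP; split => t /=; rewrite in_itv/= andbT.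
  - rewrite [_ <= f _]leNgt fe pq andbT [_ <= t]leNgt => H.
    by apply/negP => /H.
  - by move=> pt /andP[]; rewrite ltNge pt.
rewrite [X in measurable X](_ : _ = setT)//.
apply/seteqP; split => // t _ /= /andP[_ pq']; move: pq.
by rewrite pq'/= -leNgt.
Qed.

(** * Integrals over intervals of the positive half-line *)

Section positive_half_line.
Variables (R : realType) (f : R -> R) (K : R).
Hypothesis mf : measurable_fun (`]0, +oo[ : set R) f.
Hypothesis f0K : forall t : R, 0 < t -> 0 <= f t <= K.

Lemma measurable_fun_oc (u v : R) : 0 <= u -> measurable_fun `]u, v] f.
Proof.
move=> u0; apply: measurable_funS mf => //.
by apply: subset_itv => //; rewrite bnd_simp.
Qed.

(** The integral of a bounded function is continuous in its upper limit and vanishes at [0], so the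
    intermediate value theorem applies. This is what turns surplus service into an earlier
    completion time. *)
Lemma integral_ivt (T x : R) :
  0 < x -> (x%:E <= \int[lebesgue_measure]_(t in `]0%R, T]) (f t)%:E)%E ->
  exists2 T' : R, 0 < T' <= T &
    (\int[lebesgue_measure]_(t in `]0%R, T']) (f t)%:E = x%:E)%E.
Proof.
move=> x0 xT.
have T0 : 0 < T.
  rewrite ltNge; apply/negP => T0; move: xT.
  by rewrite set_itv_ge ?bnd_simp -?leNgt// integral_set0 lee_fin leNgt x0.
(* Nothing is known about [f] at [0]; extension by zero gives a bounded measurable function on the
   closed interval [[0, v]]. *)
pose g := f \_ (`]0, +oo[ : set R).
have mg : measurable_fun setT g by exact/(measurable_restrictT _ _).1.
have gE v : (\int[lebesgue_measure]_(t in `]0%R, v]) (f t)%:E =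
    \int[lebesgue_measure]_(t in `[0%R, v]) (g t)%:E)%E.
  rewrite -integral_itv_obnd_cbnd.
    apply: eq_integral => t; rewrite inE/= in_itv/= => /andP[t0 _].
    by rewrite /g patchE mem_set //= in_itv/= t0.
  exact/measurable_EFinP/measurable_funTS.
have g0K t : `|g t| <= K.
  have K0 : 0 <= K by have /andP[/le_trans] := @f0K 1 ltr01; exact.
  rewrite /g patchE; case: ifPn => [|_]; last by rewrite normr0.
  by rewrite inE/= in_itv/= andbT => /f0K/andP[h1 h2]; rewrite ger0_norm.
have ig v : lebesgue_measure.-integrable `[0, v] (EFin \o g).
  apply: measurable_bounded_integrable => //=.
  - by rewrite lebesgue_measure_itv/=; case: ifP => // _; rewrite -EFinD ltry.
  - exact: measurable_funTS.
  - exists K; split => [|r Kr t _]; first exact: num_real.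
    exact: (le_trans (g0K _) (ltW Kr)).
have fE v : (\int[lebesgue_measure]_(t in `[0%R, v]) (g t)%:E)%E =
    (parameterized_integral lebesgue_measure 0 v g)%:E.
  rewrite /parameterized_integral /Rintegral fineK//.
  exact: integrable_fin_num.
have := IVT (v := x) (ltW T0)
  (parameterized_integral_continuous (ltW T0) (ig T)).
have P0 : parameterized_integral lebesgue_measure 0 0 g = 0.
  rewrite /parameterized_integral set_itv1 /Rintegral.
  by rewrite (@integral_Sset1 _ _ _ 0).
rewrite P0.
move: xT; rewrite gE fE lee_fin => xT.
case=> [|T' ]; first by rewrite ge_min le_max (ltW x0) xT orbT.
rewrite in_itv/= => /andP[T'0 T'T] PT'.
exists T'; last by rewrite gE fE PT'.
rewrite T'T andbT lt_neqAle T'0 andbT; apply/eqP => T'E.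
by move: x0; rewrite -PT' -T'E P0 ltxx.
Qed.

End positive_half_line.

(* Both sides are kept nonnegative so that no integrability is needed. *)
Lemma integral_trade_lt (R : realType) (f h : R -> R) (T u v d p q : R) :
  measurable_fun (`]0, +oo[ : set R) f ->
  measurable_fun (`]0, +oo[ : set R) h ->
  (forall t : R, 0 < t -> 0 <= f t) -> (forall t, 0 < t -> 0 <= h t) ->
  0 < u -> 0 < v -> 0 < d -> u + d <= T -> v + d <= T -> 0 <= q -> q < p ->
  (forall t : R, 0 < t ->
     f t + p * \1_(`[u, u + d[) t <= h t + q * \1_(`[v, v + d[) t) ->
  (\int[lebesgue_measure]_(t in `]0%R, T]) (f t)%:E < +oo ->
  \int[lebesgue_measure]_(t in `]0%R, T]) (f t)%:E <
  \int[lebesgue_measure]_(t in `]0%R, T]) (h t)%:E)%E.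
Proof.
move=> mf mh f0 h0 u0 v0 d0 uT vT q0 qp fh ffin.
have intI (k : R) (g : R -> R) (r : R) : measurable_fun (`]0, +oo[ : set R) g ->
    (forall t : R, 0 < t -> 0 <= g t) -> 0 <= r -> 0 < k -> k + d <= T ->
  (\int[lebesgue_measure]_(t in `]0%R, T]) (g t + r * \1_(`[k, k + d[) t)%:E =
   \int[lebesgue_measure]_(t in `]0%R, T]) (g t)%:E + (r * d)%:E)%E.
  move=> mg g0 r0 k0 kT.
  under eq_integral do rewrite EFinD.
  rewrite ge0_integralD//=.
  - congr (_ + _)%E; under eq_integral do rewrite EFinM.
    rewrite ge0_integralZl_EFin//=.
    + rewrite integral_indic//= setIidl; last first.
        by apply: subset_itv; rewrite bnd_simp.
      rewrite lebesgue_measure_itv/= lte_fin ifT; last lra.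
      by rewrite -EFinD -EFinM; congr (_%:E); ring.
    + exact/measurable_EFinP.
  - by move=> t /=; rewrite in_itv/= => /andP[/g0].
  - by apply/measurable_EFinP; apply: measurable_fun_oc.
  - by move=> t _; rewrite lee_fin mulr_ge0.
  - by apply/measurable_EFinP; apply: measurable_funM => //.
have p0 : 0 <= p by lra.
have mI k r (g : R -> R) : measurable_fun (`]0, +oo[ : set R) g ->
    measurable_fun (`]0, T] : set R)
      (fun t => (g t + r * \1_(`[k, k + d[) t)%:E).
  move=> mg; apply/measurable_EFinP; apply: measurable_funD.
    exact: measurable_fun_oc.
  by apply: measurable_funM.
have : (\int[lebesgue_measure]_(t in `]0%R, T])
          (f t + p * \1_(`[u, u + d[) t)%:E <=
        \int[lebesgue_measure]_(t in `]0%R, T])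
          (h t + q * \1_(`[v, v + d[) t)%:E)%E.
  apply: ge0_le_integral => //.
  - move=> t /=; rewrite in_itv/= => /andP[/f0 ft _].
    by rewrite lee_fin addr_ge0// mulr_ge0.
  - exact: mI.
  - exact: mI.
  - by move=> t /=; rewrite in_itv/= => /andP[/fh ft _]; rewrite lee_fin.
rewrite !intI//.
have : (0%:E <= \int[lebesgue_measure]_(t in `]0%R, T]) (f t)%:E)%E.
  by apply: integral_ge0 => t /=; rewrite in_itv/= => /andP[/f0].
(* The integral of [f] is a real number by nonnegativity and [ffin]; if that of [h] is infinite, the
   claim is immediate. *)
move: ffin; case: (integral _ _ _) => [F||]//= _ _.
case: (integral _ _ _) => [G||]//=; last by rewrite ltry.
rewrite -!EFinD !lee_fin lte_fin.
have : q * d < p * d by rewrite ltr_pM2r.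
lra.
Qed.

(** * Tangents and slopes of the speedup function *)

Section speedup_theory.
Variables (R : realType) (B : R) (s ds : R -> R).
Hypothesis hs : speedup B s ds.

Lemma speedup_ge0 (a : R) : 0 <= a <= B -> 0 <= s a.
Proof.
case: hs => s0 smono _ _ _ /andP[]; rewrite le_eqVlt => /predU1P[<-|a0] aB.
  by rewrite s0.
by rewrite -s0 ltW// smono.
Qed.

Lemma speedup_le_max (a : R) : 0 <= a <= B -> s a <= s B.
Proof.
case: hs => _ smono _ _ _ /andP[a0]; rewrite le_eqVlt => /predU1P[->//|aB].
by rewrite ltW// smono.
Qed.

(** By concavity, the difference quotient at a point close to [x] on the way to [y] is at least as
    favourable as the chord, and these quotients tend to [ds x]. The end points [0] and [B] are
    covered, with one-sided derivatives. *)
Lemma speedup_tangent (x y : R) : 0 <= x <= B -> 0 <= y <= B ->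
  s y - s x <= ds x * (y - x).
Proof.
move=> xB yB; have [->|yx] := eqVneq y x; first by rewrite !subrr mulr0.
rewrite leNgt; apply/negP => H.
have n0 : 0 < `|y - x| by rewrite normr_gt0 subr_eq0.
(* Under [H], [e] is the distance between the chord slope and [ds x]. *)
pose e := (s y - s x - ds x * (y - x)) / `|y - x|.
have e0 : 0 < e by rewrite divr_gt0// subr_gt0.
case: hs => _ _ conc /(_ x xB) /cvgrPdist_lt/(_ e e0) + _.
rewrite near_withinE => -[d /= d0 dP].
(* Below [1] for strict concavity, and small enough to put [z] within [d] of [x]. *)
pose l := Num.min 2^-1 (d / 2 / `|y - x|).
have l0 : 0 < l by rewrite lt_min invr_gt0 ltr0n !divr_gt0.
have l1 : l < 1 by rewrite gt_min invf_lt1 ?ltr0n// ltr1n.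
have ld : l * `|y - x| < d.
  rewrite (@le_lt_trans _ _ (d / 2))//; last by lra.
  by rewrite -ler_pdivlMr// ge_min lexx orbT.
have := conc y x l yB xB yx; rewrite l0 l1 => /(_ isT).
set z := l * y + (1 - l) * x => sz.
have zx : z - x = l * (y - x) by rewrite /z; ring.
have zB : 0 <= z <= B by rewrite /z; nra.
have znx : z != x.
  rewrite -subr_eq0 zx; apply: mulf_neq0; first by rewrite gt_eqF.
  by rewrite subr_eq0.
have {dP} := dP z; rewrite /= distrC zx normrM gtr0_norm// in_itv/= => /(_ ld).
have zD : (0 <= z <= B) /\ z <> x by split => //; apply/eqP.
move=> /(_ zD); set S := _ / _ => Se.
have Sl : s y - s x <= S * (y - x).
  have -> : S * (y - x) = (s z - s x) / l.
    by rewrite /S; field; rewrite gt_eqF//= subr_eq0.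
  by rewrite ler_pdivlMr//; lra.
have : (S - ds x) * (y - x) < s y - s x - ds x * (y - x).
  apply: le_lt_trans (ler_norm _) _.
  by rewrite normrM -ltr_pdivlMr// distrC.
by rewrite mulrBl; lra.
Qed.

(** Monotonicity gives [0 < s B - s b], and the tangent at [b] bounds this by [ds b * (B - b)]. *)
Lemma dspeedup_gt0 (b : R) : 0 <= b < B -> 0 < ds b.
Proof.
move=> /andP[b0 bB]; case: hs => _ smono _ _ _.
have := smono _ _ b0 bB (lexx B).
have := @speedup_tangent b B; rewrite b0 ltW// lexx (le_trans b0 (ltW bB)).
move=> /(_ isT isT) h1 h2.
by rewrite -(pmulr_lgt0 _ (_ : 0 < B - b)) ?subr_gt0//; lra.
Qed.

Lemma dspeedup_near (x e : R) : 0 <= x <= B -> 0 < e ->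
  exists2 d : R, 0 < d &
    forall y : R, 0 <= y <= B -> `|y - x| < d -> `|ds y - ds x| < e.
Proof.
move=> xB e0; case: hs => _ _ _ _ /subspace_continuousP/(_ x).
rewrite /= in_itv/= => /(_ xB)/cvgrPdist_lt/(_ e e0).
rewrite near_withinE => -[d /= d0 dP]; exists d => // y yB yx.
by rewrite distrC; apply: dP; rewrite /= ?in_itv//= distrC.
Qed.

(** The tangents at [f t] and at [f u] bound [s (f u) - s (f t)] from both sides by a multiple of
    the increment of [f]; continuity of [ds] makes the constant [C] uniform for [u] near [t]. *)
Lemma speedup_comp_right (f : R -> R) (t : R) :
  (forall u : R, t <= u -> 0 <= f u <= B) -> f @ t^'+ --> f t ->
  s \o f @ t^'+ --> s (f t).
Proof.
move=> fB /cvgrPdist_lt fc; have ftB := fB _ (lexx t).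
have [d d0 dP] := dspeedup_near ftB ltr01.
set C := `|ds (f t)| + 1.
have C0 : 0 < C by rewrite ltr_wpDl.
apply/cvgrPdist_le => e e0; near=> u.
have fuB : 0 <= f u <= B by apply: fB; near: u; exact: nbhs_right_ge.
have fue : `|f u - f t| < e / C.
  by rewrite distrC; near: u; apply: fc; rewrite divr_gt0.
have fud : `|f u - f t| < d.
  by rewrite distrC; near: u; exact: fc.
have {}dP := dP _ fuB fud.
have CE : `|f u - f t| * C < e by rewrite -ltr_pdivlMr.
have tg (y : R) : `|y| <= C -> y * (f u - f t) <= `|f u - f t| * C.
  move=> yC; apply: le_trans (ler_norm _) _; rewrite normrM mulrC.
  by rewrite ler_wpM2l.
have h1 := speedup_tangent ftB fuB; have h2 := speedup_tangent fuB ftB.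
have h3 := tg (ds (f t)) ltac:(rewrite /C; lra).
have h4 := tg (- ds (f u)); rewrite normrN in h4.
have : `|ds (f u)| <= C.
  rewrite -[ds (f u)](subrK (ds (f t))) /C addrC.
  by apply: le_trans (ler_normD _ _) _; rewrite lerD2l ltW.
move=> /h4; rewrite mulNr => {}h4.
by rewrite /= ler_norml; apply/andP; split; lra.
Unshelve. all: by end_near. Qed.

End speedup_theory.

Section speedup_steps.
Variables (R : realType) (B : R) (s ds : R -> R).
Hypothesis hs : speedup B s ds.

(* Only the weak inequality holds at [c = B], where [ds] may vanish. *)
Lemma dspeedup_ge0 (c : R) : 0 < B -> 0 <= c <= B -> 0 <= ds c.
Proof.
move=> B0 cB; have [cltB|Bc] := ltP c B.
  by apply/ltW/(dspeedup_gt0 hs); rewrite cltB andbT; case/andP: cB.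
rewrite leNgt; apply/negP => dc; have dc' : 0 < - ds c by rewrite oppr_gt0.
have [d d0 dP] := dspeedup_near hs cB dc'.
(* Here [c = B]: by continuity a negative [ds c] would make [ds] negative at some [y < B], where it
   is positive. *)
pose y := Num.max 0 (B - d / 2).
have y0 : 0 <= y by rewrite le_max lexx.
have yB : y < B by rewrite gt_max B0/=; lra.
have yc : `|y - c| < d.
  have : B - d / 2 <= y by rewrite le_max lexx orbT.
  by rewrite ltr_norml => ?; apply/andP; split; lra.
have := dP y _ yc; rewrite y0 ltW// => /(_ isT); rewrite ltr_norml => /andP[_].
by have := @dspeedup_gt0 _ _ _ _ hs y; rewrite y0 yB => /(_ isT); lra.
Qed.

(** The tangent is taken at the far end [y + h] of the step, so that control of [ds] at this one
    point suffices; [speedup_loss] does the same at [y - h]. *)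
Lemma speedup_gain (y h m k : R) : 0 <= y -> y + h <= B -> 0 <= h ->
  `|ds (y + h) - m| < k -> s y + (m - k) * h <= s (y + h).
Proof.
move=> y0 yB h0; rewrite ltr_norml => /andP[mk _].
have := @speedup_tangent _ _ _ _ hs (y + h) y ltac:(lra) ltac:(lra).
have : (m - k) * h <= ds (y + h) * h by rewrite ler_wpM2r//; lra.
have -> : y - (y + h) = - h by ring.
by rewrite mulrN; lra.
Qed.

Lemma speedup_loss (y h m k : R) : 0 <= y - h -> y <= B -> 0 <= h ->
  `|ds (y - h) - m| < k -> s y <= s (y - h) + (m + k) * h.
Proof.
move=> y0 yB h0; rewrite ltr_norml => /andP[_ mk].
have := @speedup_tangent _ _ _ _ hs (y - h) y ltac:(lra) ltac:(lra).
have : ds (y - h) * h <= (m + k) * h by rewrite ler_wpM2r//; lra.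
have -> : y - (y - h) = h by ring.
by lra.
Qed.

End speedup_steps.

(** [r] is taken slightly above [b / z], where [c * r] is still below [a]; the margin [k] will
    absorb the errors of the first-order estimates. In the application [a], [b] are the slopes of
    [i], [j] at [t1], and [c], [z] those at [t2]. *)
Lemma exchange_rate (R : realFieldType) (a b c z : R) :
  0 < b -> 0 <= c -> 0 < z -> c * b < a * z ->
  exists r k : R, [/\ 0 < r, 0 < k, (c + k) * r < a - k & b + k < (z - k) * r].
Proof.
move=> b0 c0 z0 H.
(* The divisor [c + 1] rather than [c] allows [c = 0]. *)
pose eta := (a * z - c * b) / (2 * (c + 1)).
have eta0 : 0 < eta by rewrite divr_gt0; lra.
have etac : eta * c < a * z - c * b.
  rewrite /eta mulrAC ltr_pdivrMr; last lra.
  by rewrite ltr_pM2l; lra.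
pose r := (b + eta) / z.
have r0 : 0 < r by rewrite divr_gt0; lra.
have rz : z * r = b + eta by rewrite /r mulrC divfK// gt_eqF.
have rc : c * r < a.
  rewrite /r mulrA ltr_pdivrMr// mulrDr; lra.
(* Both required inequalities rearrange to [k * (1 + r)] being less than one of the two gaps. *)
pose k := Num.min (a - c * r) (z * r - b) / (2 * (1 + r)).
have m0 : 0 < Num.min (a - c * r) (z * r - b).
  by rewrite lt_min; apply/andP; split; lra.
have k0 : 0 < k by rewrite divr_gt0//; lra.
have kr : k * (1 + r) < Num.min (a - c * r) (z * r - b).
  rewrite /k mulrAC ltr_pdivrMr; last lra.
  by rewrite ltr_pM2l//; lra.
exists r, k; split=> //; move: kr; rewrite lt_min => /andP[h1 h2]; nra.
Qed.

(** * Right-continuous modifications of schedules *)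

Lemma right_continuous_if (R : realType) (f g : R -> R) (c t : R) :
  f @ t^'+ --> f t -> g @ t^'+ --> g t ->
  (fun u => if u < c then f u else g u) @ t^'+ --> (if t < c then f t else g t).
Proof.
move=> fc gc; have [tc|ct] := ltP t c.
  apply: cvg_trans fc; apply: near_eq_cvg; near=> u.
  by rewrite ifT//; near: u; exact: nbhs_right_lt.
apply: cvg_trans gc; apply: near_eq_cvg; near=> u.
have tu : t <= u by near: u; exact: nbhs_right_ge.
by rewrite ifF//; apply/negbTE; rewrite -leNgt (le_trans ct).
Unshelve. all: by end_near. Qed.

Lemma right_continuous_indic (R : realType) (a b t : R) :
  \1_(`[a, b[) @ t^'+ --> (\1_(`[a, b[) t : R).
Proof.
pose F (u : R) : R := if u < a then 0 else if u < b then 1 else 0.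
have FE : \1_(`[a, b[) = F.
  apply/funext => u; rewrite indicE /F; have [ua|au] := ltP u a.
    by rewrite memNset//= in_itv/= leNgt ua.
  have [ub|bu] := ltP u b; first by rewrite mem_set//= in_itv/= au ub.
  by rewrite memNset//= in_itv/= au ltNge bu.
rewrite FE /F; apply: (right_continuous_if (f := fun=> 0)).
  exact: cvg_cst.
by apply: (right_continuous_if (f := fun=> 1) (g := fun=> 0)); exact: cvg_cst.
Qed.

Lemma right_continuous_window (R : realType) (f : R -> R) (t e : R) :
  f @ t^'+ --> f t -> 0 < e ->
  exists2 d : R, 0 < d & forall u : R, t <= u < t + d -> `|f u - f t| < e.
Proof.
move=> /cvgrPdist_lt/[apply] /right_nearP[d d0 dP] //; exists d => // u.
case/andP; rewrite le_eqVlt => /predU1P[<- _|tu ud]; last first.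
  by rewrite distrC; apply: dP; rewrite tu.
by move: (dP (t + d / 2) ltac:(lra)); rewrite subrr normr0; apply: le_lt_trans.
Qed.

Lemma speed_measurable (R : realType) (B : R) (s ds f : R -> R) :
  speedup B s ds -> (forall t : R, 0 < t -> 0 <= f t <= B) ->
  (forall t : R, 0 < t -> f @ t^'+ --> f t) ->
  measurable_fun (`]0, +oo[ : set R) (s \o f).
Proof.
move=> hs fB fc; apply: right_continuous_measurable => t t0.
apply: (speedup_comp_right hs) (fc _ t0) => u tu.
exact/fB/(lt_le_trans t0).
Qed.

(* Surplus service can be cut off earlier, which lowers the cost. *)
Lemma optimal_no_slack (R : realType) (M : nat) (B : R) (s ds : R -> R)
    (x w : 'I_M -> R) (th th' : 'I_M -> R -> R) (T : 'I_M -> R) :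
  0 < B -> speedup B s ds ->
  (forall k, 0 < x k) -> (forall k, 0 < w k) -> optimal B s x w th T ->
  (forall k (t : R), 0 < t -> 0 <= th' k t <= B) ->
  (forall k (t : R), 0 < t -> th' k @ t^'+ --> th' k t) ->
  (forall t : R, 0 < t -> \sum_(k < M) th' k t <= B) ->
  (forall k, ((x k)%:E <= service s (th' k) 0 (T k))%E) ->
  forall k, ~ ((x k)%:E < service s (th' k) 0 (T k))%E.
Proof.
move=> B0 hs x0 w0 [_ opt] bnd rc sumB slack k0 strict.
have sK k t : 0 < t -> 0 <= s (th' k t) <= s B.
  move=> t0; have tB := bnd k _ t0.
  by rewrite (speedup_ge0 hs tB) (speedup_le_max hs tB).
have ms k : measurable_fun (`]0, +oo[ : set R) (s \o th' k).
  exact: speed_measurable hs (bnd k) (rc k).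
have /choice[T' T'P] : forall k, exists T' : R, 0 < T' <= T k /\
    service s (th' k) 0 T' = (x k)%:E.
  move=> k.
  by have [T' ? ?] := integral_ivt (ms k) (sK k) (x0 k) (slack k); exists T'.
(* The strict test preserves right-continuity at [T' k]; the single instant lost does not affect the
   service. *)
pose th2 k t := if t < T' k then th' k t else 0.
suff /opt : feasible B s x th2 T'.
  (* No term increases, and that of [k0] decreases strictly: [T' k0 = T k0] would contradict
     [strict]. *)
  apply/negP; rewrite -ltNge /cost (bigD1 k0)//= [X in _ < X](bigD1 k0)//=.
  apply: ltr_leD; last first.
    apply: ler_sum => k _; rewrite ler_pM2l//.
    by have [/andP[]] := T'P k.
  rewrite ltr_pM2l// lt_neqAle; have [/andP[_ ->] sx] := T'P k0.
  by rewrite andbT; apply/eqP => TE; move: strict; rewrite -TE sx ltxx.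
split.
- move=> k t t0; rewrite /th2; case: ifP => _; first exact: bnd.
  by rewrite lexx ltW.
- move=> k t t0; apply: (right_continuous_if (g := fun=> 0)); first exact: rc.
  exact: cvg_cst.
- move=> t t0; apply: le_trans (sumB t t0); apply: ler_sum => k _.
  by rewrite /th2; case: ifP => // _; have /andP[] := bnd k t t0.
- move=> k; have [T'k <-] := T'P k; rewrite /service.
  have mo (g : R -> R) : measurable_fun (`]0, +oo[ : set R) g ->
      measurable_fun (`]0, T' k[ : set R) (fun t => (g t)%:E).
    move=> mg; apply/measurable_EFinP; apply: measurable_funS mg => //.
    by apply: subset_itv; rewrite bnd_simp.
  have eqs t : t \in `]0, T' k[%classic ->
      (s (th2 k t))%:E = (s (th' k t))%:E.
    by rewrite inE/= in_itv/= => /andP[_ tT]; rewrite /th2 tT.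
  rewrite -!integral_itv_bndo_bndc.
  + exact: eq_integral.
  + exact: mo (ms k).
  + by apply: eq_measurable_fun (mo _ (ms k)) => t tT; rewrite eqs.
- by move=> k t T't; rewrite /th2 ifF// ltNge ltW.
Qed.

(** One radius bounds both the base point and the step: it is half the continuity radius of [ds], so
    [y + h] and [y - h] remain where [ds] is within [k] of [ds m]. *)
Lemma speedup_step_near (R : realType) (B : R) (s ds : R -> R) (m k : R) :
  speedup B s ds -> 0 <= m <= B -> 0 < k ->
  exists2 d : R, 0 < d & forall y h : R, `|y - m| < d -> 0 <= h <= d ->
    (0 <= y -> y + h <= B -> s y + (ds m - k) * h <= s (y + h)) /\
    (h <= y -> y <= B -> s y <= s (y - h) + (ds m + k) * h).
Proof.
move=> hs mB k0; have [d d0 dP] := dspeedup_near hs mB k0.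
exists (d / 2) => [|y h]; first lra.
rewrite ltr_norml => ym hd; split=> yl yu.
  apply: (speedup_gain hs); [by []|lra|lra|].
  by apply: dP; [lra|rewrite ltr_norml; lra].
apply: (speedup_loss hs); [lra|lra|lra|].
by apply: dP; [lra|rewrite ltr_norml; lra].
Qed.

(** Used to meet a whole list of smallness requirements with one parameter. *)
Lemma exists_pos_lower_bound (R : realFieldType) (l : seq R) :
  all (fun z => 0 < z) l -> exists2 e : R, 0 < e & all (fun z => e <= z) l.
Proof.
elim: l => [_|z l IH /= /andP[z0 /IH[e e0 el]]]; first by exists 1.
exists (Num.min z e); first by rewrite lt_min z0.
rewrite ge_min lexx/=; apply: sub_all el => y ey.
by rewrite ge_min ey orbT.
Qed.

Lemma ge_of_near_twice (R : realFieldType) (e y z : R) :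
  e <= y / 2 -> `|z - y| < e -> e <= z.
Proof. by rewrite ltr_norml => ? ?; lra. Qed.

(** * Transfers between two jobs during short windows *)

Section transfer.
Variables (R : realType) (M : nat) (th : 'I_M -> R -> R) (i j : 'I_M).
Hypothesis ij : i != j.

(** A single formula for all jobs makes conservation of the total and right-continuity uniform in
    [k]. *)
Definition transfer (g : R -> R) (k : 'I_M) (t : R) : R :=
  th k t + ((k == i)%:R - (k == j)%:R) * g t.

Lemma transfer_fst g t : transfer g i t = th i t + g t.
Proof. by rewrite /transfer eqxx (negbTE ij) subr0 mul1r. Qed.

Lemma transfer_snd g t : transfer g j t = th j t - g t.
Proof. by rewrite /transfer eqxx eq_sym (negbTE ij) sub0r mulN1r. Qed.

Lemma transfer_other g k t : k != i -> k != j -> transfer g k t = th k t.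
Proof.
by move=> /negbTE ki /negbTE kj; rewrite /transfer ki kj subrr mul0r addr0.
Qed.

Lemma transfer_sum g t : \sum_(k < M) transfer g k t = \sum_(k < M) th k t.
Proof.
rewrite /transfer big_split/= -mulr_suml sumrB.
have sum1 (l : 'I_M) : \sum_(k < M) (k == l)%:R = 1 :> R.
  by rewrite (bigD1 l)//= eqxx big1 ?addr0// => k /negbTE ->.
by rewrite !sum1 subrr mul0r addr0.
Qed.

Lemma transfer_ge0 g t : (forall k, 0 <= th k t) ->
  0 <= th i t + g t -> 0 <= th j t - g t -> forall k, 0 <= transfer g k t.
Proof.
move=> th0 gi gj k; have [->|ki] := eqVneq k i; first by rewrite transfer_fst.
have [->|kj] := eqVneq k j; first by rewrite transfer_snd.
by rewrite transfer_other.
Qed.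

End transfer.

Lemma sum_two_le (R : realType) (M : nat) (f : 'I_M -> R) (i j : 'I_M) :
  i != j -> (forall k, 0 <= f k) -> f i + f j <= \sum_(k < M) f k.
Proof.
move=> ij f0; rewrite (bigD1 i)//= (bigD1 j) 1?eq_sym//= addrA lerDl.
exact: sumr_ge0.
Qed.

(** Windows closed on the left and open on the right keep right-continuity. Negation exchanges the
    two windows, so the change for [j] is again a pulse. *)
Definition pulse (R : realType) (t1 t2 d h1 h2 t : R) : R :=
  h1 * \1_(`[t1, t1 + d[%classic) t - h2 * \1_(`[t2, t2 + d[%classic) t.

Lemma pulseN (R : realType) (t1 t2 d h1 h2 t : R) :
  - pulse t1 t2 d h1 h2 t = pulse t2 t1 d h2 h1 t.
Proof. by rewrite /pulse opprB. Qed.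

Lemma pulse_right_continuous (R : realType) (t1 t2 d h1 h2 t : R) :
  pulse t1 t2 d h1 h2 @ t^'+ --> pulse t1 t2 d h1 h2 t.
Proof.
by apply: cvgB; apply: cvgM; [exact: cvg_cst|exact: right_continuous_indic
  |exact: cvg_cst|exact: right_continuous_indic].
Qed.

Lemma windows_disjoint (R : realType) (t1 t2 d t : R) : d <= `|t1 - t2| ->
  [\/ [/\ t1 <= t < t1 + d, \1_(`[t1, t1 + d[%classic) t = 1 :> R &
          \1_(`[t2, t2 + d[%classic) t = 0 :> R],
      [/\ t2 <= t < t2 + d, \1_(`[t1, t1 + d[%classic) t = 0 :> R &
          \1_(`[t2, t2 + d[%classic) t = 1 :> R] |
      \1_(`[t1, t1 + d[%classic) t = 0 :> R /\
      \1_(`[t2, t2 + d[%classic) t = 0 :> R].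
Proof.
move=> dt; rewrite !indicE !mem_setE !in_itv/=.
case: (boolP (t1 <= t < t1 + d)) => tW1; last first.
  by case: (boolP (t2 <= t < t2 + d)) => _; [constructor 2|constructor 3].
constructor 1; split => //; case: (boolP (t2 <= t < t2 + d)) => // tW2.
by exfalso; case: (lerP t2 t1) dt; lra.
Qed.

Lemma pulse_cases (R : realType) (t1 t2 d h1 h2 t : R) (P : R -> Prop) :
  d <= `|t1 - t2| -> (t1 <= t < t1 + d -> P h1) ->
  (t2 <= t < t2 + d -> P (- h2)) -> P 0 -> P (pulse t1 t2 d h1 h2 t).
Proof.
move=> dt P1 P2 P0; rewrite /pulse.
have [[tW -> ->]|[tW -> ->]|[-> ->]] := windows_disjoint t dt.
- by rewrite mulr1 mulr0 subr0; exact: P1.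
- by rewrite mulr1 mulr0 sub0r; exact: P2.
- by rewrite !mulr0 subr0.
Qed.

(** The windows have equal length, so comparing the rate gained [p] with the rate lost [q] decides
    the balance. It serves both jobs, with the windows exchanged for [j]. *)
Lemma service_pulse_lt (R : realType) (B : R) (s ds f : R -> R)
    (T t1 t2 d h1 h2 p q : R) :
  let f' t := f t + pulse t1 t2 d h1 h2 t in
  speedup B s ds ->
  (forall t : R, 0 < t -> 0 <= f t <= B) ->
  (forall t : R, 0 < t -> 0 <= f' t <= B) ->
  (forall t : R, 0 < t -> f @ t^'+ --> f t) ->
  0 < t1 -> 0 < t2 -> 0 < d -> t1 + d <= T -> t2 + d <= T ->
  d <= `|t1 - t2| -> 0 <= q -> q < p ->
  (forall t : R, t1 <= t < t1 + d -> s (f t) + p <= s (f t + h1)) ->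
  (forall t : R, t2 <= t < t2 + d -> s (f t) <= s (f t - h2) + q) ->
  (service s f 0 T < +oo)%E -> (service s f 0 T < service s f' 0 T)%E.
Proof.
move=> f' hs fB fB' fc t10 t20 d0 t1T t2T dt q0 qp gain loss.
have fc' (t : R) : 0 < t -> f' @ t^'+ --> f' t.
  by move=> t0; apply: cvgD; [exact: fc|exact: pulse_right_continuous].
apply: (integral_trade_lt (u := t1) (v := t2) (d := d) (p := p) (q := q)
  (speed_measurable hs fB fc) (speed_measurable hs fB' fc')) => //.
- by move=> t t0; apply: (speedup_ge0 hs); exact: fB.
- by move=> t t0; apply: (speedup_ge0 hs); exact: fB'.
- move=> t t0; rewrite /= /f' /pulse.
  have [[tW -> ->]|[tW -> ->]|[-> ->]] := windows_disjoint t dt.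
  + by rewrite !mulr1 !mulr0 subr0 addr0; exact: gain.
  + by rewrite !mulr1 !mulr0 sub0r addr0; exact: loss.
  + by rewrite !mulr0 subr0 !addr0.
Qed.

(** * The exchange argument *)

Unset Implicit Arguments.

Theorem theorem2 (R : realType) (M : nat) (B : R) (s ds : R -> R)
    (x w : 'I_M -> R)
    (hB : 0 < B) (hs : speedup B s ds)
    (hx_pos : forall i, 0 < x i)
    (hx_mono : forall i j : 'I_M, (i <= j)%N -> x j <= x i)
    (hw_pos : forall i, 0 < w i)
    (hw_mono : forall i j : 'I_M, (i <= j)%N -> w i <= w j)
    (th : 'I_M -> R -> R) (T : 'I_M -> R)
    (hopt : optimal B s x w th T)
    (i j : 'I_M) (t1 t2 : R)
    (ht1 : 0 < t1) (ht2 : 0 < t2)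
    (hT : Num.max t1 t2 < Num.min (T i) (T j))
    (hi1 : 0 < th i t1) (hj1 : 0 < th j t1)
    (hi2 : 0 < th i t2) (hj2 : th j t2 = 0) :
  ds (th i t1) / ds (th j t1) <= ds (th i t2) / ds 0.
Proof.
rewrite leNgt; apply/negP => bad.
have [bnd rc sumB serv _] := hopt.1.
move: hT; rewrite gt_max => /andP[t1S t2S].
set S := Num.min (T i) (T j) in t1S t2S.
have /andP[Si Sj] : (S <= T i) && (S <= T j) by rewrite -le_min.
have ij : i != j by apply/eqP => ijE; move: hi2; rewrite ijE hj2 ltxx.
have t12 : t1 != t2 by apply/eqP => tE; move: hj1; rewrite tE hj2 ltxx.
have nn (t : R) : 0 < t -> forall k, 0 <= th k t.
  by move=> t0 k; have /andP[] := bnd k t t0.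
have pairB (t : R) : 0 < t -> th i t + th j t <= B.
  by move=> t0; exact: le_trans (sum_two_le ij (nn t t0)) (sumB t t0).
have aB : 0 <= th i t1 < B by have := pairB t1 ht1; lra.
have bB : 0 <= th j t1 < B by have := pairB t1 ht1; lra.
have zB : 0 <= (0 : R) < B by rewrite lexx.
(* At [t2] job [i] may hold the whole resource, so the slope there is only known to be
   nonnegative. *)
have cB : 0 <= th i t2 <= B by exact: bnd.
have ds0 := dspeedup_gt0 hs zB.
have dsb := dspeedup_gt0 hs bB.
have dsc := dspeedup_ge0 hs hB cB.
have [r [kp [r0 kp0 rate_i rate_j]]] : exists r k : R, [/\ 0 < r, 0 < k,
    (ds (th i t2) + k) * r < ds (th i t1) - k &
    ds (th j t1) + k < (ds 0 - k) * r].
  apply: exchange_rate => //.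
  by move: bad; rewrite ltr_pdivrMr// mulrAC ltr_pdivlMr.
have leB (y : R) : 0 <= y < B -> 0 <= y <= B by move=> /andP[-> /ltW].
have [da da0 daP] := speedup_step_near hs (leB _ aB) kp0.
have [db db0 dbP] := speedup_step_near hs (leB _ bB) kp0.
have [dc dc0 dcP] := speedup_step_near hs cB kp0.
have [dz dz0 dzP] := speedup_step_near hs (leB _ zB) kp0.
(* The first four bounds validate the slope estimates; the two halves keep the donor's rate at least
   [e] throughout its window. *)
have [e e0] : exists2 e : R, 0 < e & all (fun z => e <= z)
    [:: da; db; dc; dz; th j t1 / 2; th i t2 / 2].
  by apply: exists_pos_lower_bound; rewrite /= da0 db0 dc0 dz0 !divr_gt0.
rewrite /= => /and5P[eda edb edc edz /and3P[eb ec _]].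
(* Ensures that both transferred rates, [h] and [r * h], are at most [e]. *)
have [h h0] : exists2 h : R, 0 < h & all (fun z => h <= z) [:: e; e / r].
  by apply: exists_pos_lower_bound; rewrite /= e0 divr_gt0.
rewrite /= ler_pdivlMr// mulrC => /and3P[he rhe _].
have rh0 : 0 < r * h by rewrite mulr_gt0.
have [d1 d10 d1P] := right_continuous_window (rc i _ ht1) e0.
have [d2 d20 d2P] := right_continuous_window (rc j _ ht1) e0.
have [d3 d30 d3P] := right_continuous_window (rc i _ ht2) e0.
have [d4 d40 d4P] := right_continuous_window (rc j _ ht2) e0.
(* [d1] to [d4] keep the rates within [e] of their initial values, [S - t1] and [S - t2] end the
   windows by both completion times, and the last entry makes them disjoint. *)
have [d d0] : exists2 d : R, 0 < d & all (fun z => d <= z)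
    [:: d1; d2; d3; d4; S - t1; S - t2; `|t1 - t2|].
  apply: exists_pos_lower_bound.
  by rewrite /= d10 d20 d30 d40 !subr_gt0 t1S t2S normr_gt0 subr_eq0 t12.
rewrite /= => /and5P[dd1 dd2 dd3 dd4 /and4P[dS1 dS2 dt _]].
have widen (t u d' : R) : d <= d' -> t <= u < t + d -> t <= u < t + d'.
  by move=> dd /andP[-> /lt_le_trans]; apply; rewrite lerD2l.
pose th' := transfer th i j (pulse t1 t2 d h (r * h)).
have pos (t u : R) : 0 < t -> t <= u < t + d -> 0 < u.
  by move=> t0 /andP[/(lt_le_trans t0)].
have jh (t : R) : t1 <= t < t1 + d -> h <= th j t.
  by move=> /(widen _ _ _ dd2)/d2P/(ge_of_near_twice eb); exact: le_trans.
have irh (t : R) : t2 <= t < t2 + d -> r * h <= th i t.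
  by move=> /(widen _ _ _ dd3)/d3P/(ge_of_near_twice ec); exact: le_trans.
have nn' (t : R) : 0 < t -> forall k, 0 <= th' k t.
  move=> t0; have iti := nn t t0 i; have jtj := nn t t0 j.
  apply: (transfer_ge0 ij (nn t t0)); rewrite ?pulseN.
    apply: (pulse_cases (P := fun z => 0 <= th i t + z)) => // [_|/irh|].
    - by rewrite addr_ge0// ltW.
    - by rewrite subr_ge0.
    - by rewrite addr0.
  apply: (pulse_cases (P := fun z => 0 <= th j t + z)) => [|_|/jh|].
  - by rewrite distrC.
  - by rewrite addr_ge0// ltW.
  - by rewrite subr_ge0.
  - by rewrite addr0.
have sumB' (t : R) : 0 < t -> \sum_(k < M) th' k t <= B.
  by move=> t0; rewrite transfer_sum; exact: sumB.
(* The upper bound follows from the conserved total, since all new rates are nonnegative. *)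
have bnd' k (t : R) : 0 < t -> 0 <= th' k t <= B.
  move=> t0; rewrite nn'//=; apply: le_trans (sumB' t t0).
  by rewrite (bigD1 k)//= lerDl sumr_ge0// => l _; exact: nn'.
have rc' k (t : R) : 0 < t -> th' k @ t^'+ --> th' k t.
  move=> t0; apply: cvgD; first exact: rc.
  by apply: cvgM; [exact: cvg_cst|exact: pulse_right_continuous].
have fin k : (service s (th k) 0 (T k) < +oo)%E by rewrite serv ltry.
have end1 (z : R) : S <= z -> t1 + d <= z.
  by apply: le_trans; rewrite addrC -lerBrDr.
have end2 (z : R) : S <= z -> t2 + d <= z.
  by apply: le_trans; rewrite addrC -lerBrDr.
have h_le (z : R) : e <= z -> 0 <= h <= z.
  by move=> ez; rewrite ltW//= (le_trans he).
have rh_le (z : R) : e <= z -> 0 <= r * h <= z.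
  by move=> ez; rewrite ltW//= (le_trans rhe).
have gain_i : ((x i)%:E < service s (th' i) 0 (T i))%E.
  have thE : th' i = fun t => th i t + pulse t1 t2 d h (r * h) t.
    by apply/funext => t; rewrite /th' transfer_fst.
  have bi := bnd' i; rewrite thE in bi *; rewrite -(serv i).
  apply: (service_pulse_lt (p := (ds (th i t1) - kp) * h)
    (q := (ds (th i t2) + kp) * (r * h)) hs (bnd i) bi (rc i)) => //.
  - exact: end1.
  - exact: end2.
  - by rewrite mulr_ge0 ?addr_ge0// ltW.
  - by rewrite mulrA ltr_pM2r.
  - move=> t tW; have t0 := pos _ _ ht1 tW.
    have near_a := lt_le_trans (d1P t (widen _ _ _ dd1 tW)) eda.
    have [gain _] := daP _ _ near_a (h_le _ eda); apply: gain; first exact: nn.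
    (* The raised rate of [i] stays within [B] because the amount [h] comes out of the share of
       [j]. *)
    by rewrite (le_trans _ (pairB t t0))// lerD2l jh.
  - move=> t tW; have t0 := pos _ _ ht2 tW.
    have near_c := lt_le_trans (d3P t (widen _ _ _ dd3 tW)) edc.
    have [_ loss] := dcP _ _ near_c (rh_le _ edc).
    apply: loss; first exact: irh.
    by have /andP[] := bnd i t t0.
(* The mirror image: [j] gains after [t2], starting from rate [0], and loses after [t1]; [rate_j]
   decides. *)
have gain_j : ((x j)%:E < service s (th' j) 0 (T j))%E.
  have thE : th' j = fun t => th j t + pulse t2 t1 d (r * h) h t.
    by apply/funext => t; rewrite /th' transfer_snd// pulseN.
  have bj := bnd' j; rewrite thE in bj *; rewrite -(serv j).
  apply: (service_pulse_lt (p := (ds 0 - kp) * (r * h))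
    (q := (ds (th j t1) + kp) * h) hs (bnd j) bj (rc j)) => //.
  - exact: end2.
  - exact: end1.
  - by rewrite distrC.
  - by rewrite mulr_ge0 ?addr_ge0// ltW.
  - by rewrite mulrA ltr_pM2r.
  - move=> t tW; have t0 := pos _ _ ht2 tW.
    have := lt_le_trans (d4P t (widen _ _ _ dd4 tW)) edz; rewrite hj2 => near_0.
    have [gain _] := dzP _ _ near_0 (rh_le _ edz); apply: gain; first exact: nn.
    by rewrite addrC (le_trans _ (pairB t t0))// lerD2r irh.
  - move=> t tW; have t0 := pos _ _ ht1 tW.
    have near_b := lt_le_trans (d2P t (widen _ _ _ dd2 tW)) edb.
    have [_ loss] := dbP _ _ near_b (h_le _ edb).
    apply: loss; first exact: jh.
    by have /andP[] := bnd j t t0.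
(* Job [i] supplies the strict surplus; it remains to see that no job falls short. *)
apply: (optimal_no_slack hB hs hx_pos hw_pos hopt bnd' rc' sumB' _ gain_i).
move=> k; have [->|ki] := eqVneq k i; first exact: ltW.
have [->|kj] := eqVneq k j; first exact: ltW.
have -> : th' k = th k by apply/funext => t; exact: transfer_other.
by rewrite serv.
Qed.
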